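(* The equivalence relation on the set $\mathcal{G}$ of closed normal o-graphs defined by the surjective map $\Phi\colon\mathcal{G}\to\mathcal{M}$, $\Gamma\mapsto\widehat M(\Gamma)$ (that is, $\Gamma\sim\Gamma'$ iff $\Phi(\Gamma)=\Phi(\Gamma')$), is generated by the primary MP move, the pure sliding moves and the CP move. In particular $\Phi$ induces a one-to-one correspondence between $\mathcal{M}$ and the set of closed normal o-graphs up to the primary MP move, pure sliding moves and the CP move.
   Context: **Normal o-graphs.** A normal o-graph is an oriented virtual link diagram (real crossings with sign $+$ or $-$) up to planar isotopy and the Reidemeister-type moves involving virtual crossings, which preserve exactly the real crossings and the way their ends are connected. Equivalently, it is the following data up to isomorphism: a finite nonempty set $V$ of vertices (real crossings), a sign in $\{+,-\}$ for each vertex, four ends (over-in, over-out, under-in, under-out) at each vertex, and a bijection from the set of all out-ends to the set of all in-ends (each matched pair is an edge), such that the resulting 4-valent graph is connected. **Dual branched triangulation.** Let $T(\Gamma)$ be the oriented complex obtained as follows. For each vertex of $\Gamma$ take a tetrahedron with ordered vertices $0<1<2<3$; let $F_i$ be the face opposite to $i$. At a positive vertex the tetrahedron is oriented so that the frame $(01,02,03)$ is negative, and over-in, over-out, under-in, under-out correspond to $F_0,F_1,F_2,F_3$. At a negative vertex the frame $(01,02,03)$ is positive, and over-in, over-out, under-in, under-out correspond to $F_1,F_0,F_3,F_2$. For each edge of $\Gamma$ glue the two corresponding faces by the order-preserving affine map (it is orientation-reversing). Then $\Gamma\mapsto T(\Gamma)$ is a bijection from normal o-graphs to connected finite complexes of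 oriented tetrahedra with ordered vertices and order-preserving, orientation-reversing pairings of all faces (up to isomorphism). Each edge of $T(\Gamma)$ is directed from its smaller to its larger end. The 2-skeleton $P(\Gamma)$ dual to $T(\Gamma)$ is a branched standard polyhedron: true vertices, edges, 2-cells of $P(\Gamma)$ are dual to tetrahedra, triangles, edges of $T(\Gamma)$; it can be smoothed so that it has a well-defined tangent plane everywhere. **Closed normal o-graphs and $\Phi$.** 3-manifolds are connected, compact, oriented. Let $M(\Gamma)$ be the regular neighbourhood of $P(\Gamma)$ in $T(\Gamma)$ ($T(\Gamma)$ minus open stars of its vertices), and $v(\Gamma)$ the (unique up to homotopy) nowhere-vanishing vector field on $M(\Gamma)$ that is positively transverse to $P(\Gamma)$, crossing each 2-cell in the direction of the dual edge of $T(\Gamma)$. It divides $\partial M(\Gamma)$ into the parts where it points outward, is tangent, points inward. $\Gamma$ is closed if $\partial M(\Gamma)\cong S^2$ with outward, tangent, inward parts $\{z<0\},\{z=0\},\{z>0\}$. Then $\widehat M(\Gamma)$ is the closed 3-manifold obtained by capping off with a ball. $\mathcal{G}$ is the set of closed normal o-graphs and $\mathcal{M}$ the set of closed 3-manifolds up to orientation-preserving diffeomorphism. **MP moves.** (Moves are described on $T(\Gamma)$.) Consider two distinct tetrahedra glued along a triangle with vertices $c<d<e$, with remaining vertices $a$ and $b$ (all five regarded as distinct vertices of an abstract bipyramid). Choose a total order on $\{a,b,c,d,e\}$ extending the orders of both tetrahedra. Replace the two tetrahedra by the three tetrahedra $\{a,b,c,d\},\{a,b,d,e\},\{a,b,c,e\}$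 around a new edge $ab$, ordered by restriction of the total order, with orientation of the bipyramid and gluings of its six outer faces unchanged. This is an MP move if $a,b$ are not both smaller than $c$ and not both larger than $e$. **Primary MP move.** The MP move in which the five vertices are ordered $v_0<v_1<v_2<v_3<v_4$, the two tetrahedra $\{v_0,v_1,v_2,v_4\}$, $\{v_0,v_2,v_3,v_4\}$ are replaced by $\{v_1,v_2,v_3,v_4\}$, $\{v_0,v_1,v_3,v_4\}$, $\{v_0,v_1,v_2,v_3\}$, and all five tetrahedra correspond to positive vertices of the normal o-graph. **Pure sliding moves.** Let $E$ be an edge of $T(\Gamma)$, with ends $x<y$. Choose two triangles $f_1,f_2$ of $T(\Gamma)$ at two different places around $E$ (two different sides of the polygonal 2-cell dual to $E$); any triangle may first be replaced by a stack of two parallel copies, so $f_1,f_2$ may also be two parallel copies of one triangle. Let $p,q$ be the third vertices of $f_1,f_2$. Choose a total order on $\{x,y,p,q\}$ (abstractly distinct vertices) compatible with the orders of $f_1$ and $f_2$, such that $p,q$ are not both smaller than $x$ and not both larger than $y$. Cut $T(\Gamma)$ open along $f_1\cup f_2$ (joined along $E$) and insert a pillow consisting of two oppositely oriented tetrahedra, both with vertices $x,y,p,q$ in the chosen order, glued to each other along the faces $xpq$ and $ypq$; its four outer faces $xyp,xyp,xyq,xyq$ are glued to the four sides of the cut. So $E$ is replaced by two edges and a new edge $pq$ appears. **CP move.** The CP (Combinatorial Pontryagin) move is a fixed local move on closed normal o-graphs introduced by Benedetti and Petronio ( *Branched Standard Spines of 3-manifolds*, LNM 1653, Figure 1.6),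 relating different combings on the same 3-manifold. Here it may be taken as a fixed binary relation on $\mathcal{G}$ with the following known property (Benedetti–Petronio, Theorem 1.4.2): the equivalence relation on $\mathcal{G}$ defined by $\Phi$ is generated by the MP moves, the $0$-$2$ move (a certain special case of a pure sliding move) and the CP move; pure sliding moves do not change $\Phi$. No other property of the CP move is to be used. *)

(* Defs.v *)
From HB Require Import structures.
From mathcomp Require Import all_boot all_order all_algebra all_fingroup.
From mathcomp Require Import all_classical all_reals all_analysis.
From Stdlib Require Import Relation_Definitions Relation_Operators.

Set Implicit Arguments.
Unset Strict Implicit.
Unset Printing Implicit Defensive.

Import Order.TTheory GRing.Theory Num.Theory.
Import numFieldNormedType.Exports.

Local Open Scope classical_set_scope.
Local Open Scope ring_scope.

(** * Normal o-graphs *)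

(* A strand of a vertex is a pair (v, o) with o = true for the over-strand and
   o = false for the under-strand. [matching g (v, o) = (w, o')] means that the
   o-out end of v is matched with the o'-in end of w. *)
Record ograph := Ograph {
  vtx :> finType;
  positive : vtx -> bool;
  matching : {perm vtx * bool};
  ograph_nonempty : (0 < #|vtx|)%N;
  ograph_connected : forall v w : vtx,
    connect [rel x y | [exists a, exists b, (matching (x, a) == (y, b))
                                         || (matching (y, a) == (x, b))]] v w
}.

Definition iso (g g' : ograph) : Prop :=
  exists f : g -> g', [/\ bijective f,
    forall v, positive (f v) = positive v
    & forall v o, matching g' (f v, o) =
        (f (matching g (v, o)).1, (matching g (v, o)).2)].

(** * The dual complex T(Gamma) *)

(* The number of the face corresponding to an end of a vertex of sign
   [s] ([true] = positive). *)
Definition end_face (s out over : bool) : 'I_4 :=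
  match s, over, out with
  | true, true, false => @Ordinal 4 0 isT
  | true, true, true => @Ordinal 4 1 isT
  | true, false, false => @Ordinal 4 2 isT
  | true, false, true => @Ordinal 4 3 isT
  | false, true, false => @Ordinal 4 1 isT
  | false, true, true => @Ordinal 4 0 isT
  | false, false, false => @Ordinal 4 3 isT
  | false, false, true => @Ordinal 4 2 isT
  end.

(* The side (v, a) is the face opposite to the vertex a of the tetrahedron v.
   [opp s] is the side glued to s. The face a of v is an out-end iff the parity
   of a agrees with the sign of v, and belongs to the over-strand iff a < 2. *)
Definition opp (g : ograph) (s : g * 'I_4) : g * 'I_4 :=
  let: (v, a) := s in
  let over := (a < 2)%N in
  if odd a == positive v then
    let: (w, o) := matching g (v, over) in (w, end_face (positive w) false o)
  else
    let: (w, o) := (matching g)^-1%g (v, over) in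
    (w, end_face (positive w) true o).

(* The rank of the vertex b among the vertices of the face opposite to a, in a
   simplex with vertices 0 < ... < n.+1; its inverse is [lift a]. The value for
   b = a is irrelevant. *)
Definition rank n (a b : 'I_n.+2) : 'I_n.+1 := odflt ord0 (unlift a b).

(* a and b are not both smaller, and not both larger, than all other labels. *)
Definition admissible n (a b : 'I_n) : bool :=
  ~~ [forall c, (c != a) && (c != b) ==> (a < c)%N && (b < c)%N] &&
  ~~ [forall c, (c != a) && (c != b) ==> (c < a)%N && (c < b)%N].

(** * MP moves *)

(* The five vertices of the bipyramid are named by their rank in 'I_5, and
   [inr k] stands for the tetrahedron whose vertices are all but k. The
   tetrahedra [inr i] and [inr j] of g (so that i and j are the two apices) are
   replaced by the three others in g'; [inl x] are the remaining tetrahedra. The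
   outer triangle of the bipyramid missing k and l (k an apex, l not) is the
   face opposite to l of [inr k] before the move and the face opposite to k of
   [inr l] after it. The boundary of the 4-simplex gives the signs, up to the
   global choice e. *)
Definition bipyramid_move (i j : 'I_5) (e : bool) (g g' : ograph) : Prop :=
  let apex k := (k == i) || (k == j) in
  exists (K : finType) (h : K + 'I_5 -> g) (h' : K + 'I_5 -> g'),
  let before x := if x is inr k then apex k else true in
  let after x := if x is inr k then ~~ apex k else true in
  let outer (o : K * 'I_4 + 'I_5 * 'I_5) :=
    if o is inr (k, l) then apex k && ~~ apex l else true in
  let side_before (o : K * 'I_4 + 'I_5 * 'I_5) :=
    match o with
    | inl (x, a) => (h (inl x), a)
    | inr (k, l) => (h (inr k), rank k l)
    end in
  let side_after (o : K * 'I_4 + 'I_5 * 'I_5) :=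
    match o with
    | inl (x, a) => (h' (inl x), a)
    | inr (k, l) => (h' (inr l), rank l k)
    end in
  (i != j) /\
  [/\ forall v : g, exists! x, before x /\ h x = v,
      forall v : g', exists! x, after x /\ h' x = v,
      forall x, positive (h' (inl x)) = positive (h (inl x)),
      forall k, apex k -> positive (h (inr k)) = odd k (+) e
    & forall k, ~~ apex k -> positive (h' (inr k)) = ~~ (odd k (+) e)] /\
  [/\ opp (h (inr i), rank i j) = (h (inr j), rank j i),
      forall k l, ~~ apex k -> ~~ apex l -> k != l ->
        opp (h' (inr k), rank k l) = (h' (inr l), rank l k)
    & forall o o', outer o -> outer o' ->
        (opp (side_before o) = side_before o' <->
         opp (side_after o) = side_after o')].

Definition MP_move (g g' : ograph) : Prop :=
  exists (i j : 'I_5) (e : bool), admissible i j /\ bipyramid_move i j e g g'.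

(* With e = false all five tetrahedra are positive. *)
Definition primary_MP_move : ograph -> ograph -> Prop :=
  bipyramid_move (@Ordinal 5 1 isT) (@Ordinal 5 3 isT) false.

(** * Pure sliding moves *)

(* Opens a fixed-point free pairing t along the pair {s, t s}, pairing s with
   the new element [inr true] and t s with [inr false]. *)
Definition open_at (S : eqType) (t : S -> S) (s : S) (x : S + bool) : S + bool :=
  match x with
  | inl y => if y == s then inr true
             else if y == t s then inr false else inl (t y)
  | inr true => inl s
  | inr false => inl (t s)
  end.

(* Here T(g) is opened along a triangle {s, opp s}; the slit has the two sides
   [inr true], [inr false]. A flag (u, r) is a side u with the edge of u
   opposite to the vertex of rank r of u. [walk] turns around this edge: it
   crosses u, and then goes to the other side containing the edge of the
   tetrahedron (or of the slit) that has been entered. *)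
Definition walk (g : ograph) (s : g * 'I_4)
    (f : (g * 'I_4 + bool) * 'I_3) : (g * 'I_4 + bool) * 'I_3 :=
  match open_at (@opp g) s f.1 with
  | inl (v, a) => let b := lift a f.2 in (inl (v, b), rank b a)
  | inr c => (inr (~~ c), f.2)
  end.

(* p, q are the places of the vertices p, q in the chosen order of {x, y, p, q},
   so that x < y are the two other elements of 'I_4. The complex is opened along
   f1 = {s, opp s}, then along f2 = {u, open_at opp s u}, where f2 is reached
   from f1 by turning around the edge E = xy; E is opposite to the vertex of
   rank [rank q p] in f1 and to the vertex of rank [rank p q] in f2. As the
   turning takes place in the opened complex, u may also be a side of the slit
   along f1, in which case f1 and f2 are parallel copies of the same triangle.
   The new tetrahedron [h (inr true)] is glued to the sides of f1 and f2 facing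
   the part of the complex that has been traversed from f1 to f2, and
   [h (inr false)] to the two other sides. *)
Definition pure_sliding (g g' : ograph) : Prop :=
  exists (p q : 'I_4) (s : g * 'I_4) (u : g * 'I_4 + bool)
         (h : g + bool -> g'),
  let slit := open_at (@opp g) s in
  let new_side (x : g * 'I_4 + bool + bool) :=
    match x with
    | inl (inl (v, a)) => (h (inl v), a)
    | inl (inr c) => (h (inr c), q)
    | inr c => (h (inr c), p)
    end in
  [/\ p != q, admissible p q
    & exists n, iter n (walk s) (inr true, rank q p) = (u, rank p q)] /\
  [/\ bijective h,
      forall v, positive (h (inl v)) = positive v
    & positive (h (inr true)) = ~~ positive (h (inr false))] /\
  (forall x, opp (new_side x) = new_side (open_at slit u x)) /\
  (forall a, a != p -> a != q -> opp (h (inr true), a) = (h (inr false), a)).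

(** * The manifold M(Gamma), its vector field, closed normal o-graphs *)

Section Realization.
Variable R : realType.

(* The points of a tetrahedron are given by their barycentric coordinates with
   respect to the vertices 1, 2, 3: the vertex 0 is the origin and the frame
   (01, 02, 03) is the standard frame of R^3. *)
Definition bary (y : 'rV[R]_3) (i : 'I_4) : R :=
  if unlift ord0 i is Some k then y 0 k else 1 - \sum_k y 0 k.

(* The tetrahedron without the open stars of its vertices. *)
Definition truncated : set 'rV[R]_3 :=
  [set y | forall i, 0 <= bary y i <= 2 / 3].

Definition truncated_interior : set 'rV[R]_3 :=
  [set y | forall i, 0 < bary y i < 2 / 3].

Definition cut (i : 'I_4) : set 'rV[R]_3 :=
  truncated `&` [set y | bary y i = 2 / 3].

Definition glued_faces (g : ograph) (x x' : g * 'rV[R]_3) : Prop :=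
  exists a b : 'I_4, [/\ opp (x.1, a) = (x'.1, b),
    bary x.2 a = 0, bary x'.2 b = 0
    & forall r : 'I_3, bary x.2 (lift a r) = bary x'.2 (lift b r)].

(* The points x and x' represent the same point of T(g). *)
Definition same_point (g : ograph) : relation (g * 'rV[R]_3) :=
  clos_refl_sym_trans _ (@glued_faces g).

(* The barycentric components of the vector field v(g). It is tangent to the
   faces and compatible with the gluings, vanishes only at the vertices of
   T(g), and for i < j it satisfies field x j - field x i > 0 on the 2-cell
   x i = x j >= (other coordinates) of P(g) dual to the edge from i to j. *)
Definition field (x : 'I_4 -> R) (i : 'I_4) : R :=
  x i * (\sum_(j < 4 | (j < i)%N) x j - \sum_(j < 4 | (i < j)%N) x j).

Definition unit_sphere : set 'rV[R]_3 := [set y | \sum_k (y 0 k) ^+ 2 = 1].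
Definition unit_ball : set 'rV[R]_3 := [set y | \sum_k (y 0 k) ^+ 2 <= 1].

(* f is a homeomorphism from the boundary of M(g), the union of the cut
   triangles, to S^2: a continuous surjection from this compact space, whose
   fibres are the classes of glued points. On the i-th cut the field points out
   of M(g) iff its i-th component is positive; this part goes to z < 0. *)
Definition is_closed (g : ograph) : Prop :=
  exists f : g -> 'rV[R]_3 -> 'rV[R]_3,
  [/\ forall v i, {within cut i, continuous (f v)},
      unit_sphere = [set z | exists v i, exists2 y, cut i y & f v y = z],
      forall v w i j y y', cut i y -> cut j y' ->
        (f v y = f w y' <-> same_point (v, y) (w, y'))
    & forall v i y, cut i y ->
        Num.sg (f v y 0 ord_max) = - Num.sg (field (bary y) i)].

Record closed_ograph := ClosedOgraph {
  ograph_of :> ograph;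
  closed_ographP : is_closed ograph_of
}.

(** * Closed oriented 3-manifolds *)

Fixpoint of_class_C (k : nat) (U : set 'rV[R]_3) (f : 'rV[R]_3 -> 'rV[R]_3) :
    Prop :=
  if k is k'.+1 then
    (forall x, U x -> differentiable f x) /\
    (forall v, of_class_C k' U (fun x => 'D_v f x))
  else forall x, U x -> {for x, continuous f}.

(* U is meant to be open. *)
Definition smooth (U : set 'rV[R]_3) (f : 'rV[R]_3 -> 'rV[R]_3) : Prop :=
  forall k, of_class_C k U f.

Definition oriented_smooth (U : set 'rV[R]_3) (f : 'rV[R]_3 -> 'rV[R]_3) :
    Prop :=
  smooth U f /\ (forall x, U x -> 0 < \det ('J f x)).

Record chart (X : topologicalType) := Chart {
  chart_dom : set X;
  coord : X -> 'rV[R]_3;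
  param : 'rV[R]_3 -> X
}.

Definition is_chart (X : topologicalType) (c : chart X) : Prop :=
  [/\ open (chart_dom c), open (coord c @` chart_dom c),
      forall x, chart_dom c x -> param c (coord c x) = x,
      {within chart_dom c, continuous (coord c)}
    & {within coord c @` chart_dom c, continuous (param c)}].

Record closed3 := Closed3 {
  space :> topologicalType;
  atlas : set (chart space);
  closed3_hausdorff : hausdorff_space space;
  closed3_compact : compact [set: space];
  closed3_nonempty : [set: space] !=set0;
  closed3_connected : connected [set: space];
  atlas_charts : forall c, atlas c -> is_chart c;
  atlas_cover : forall x, exists2 c, atlas c & chart_dom c x;
  atlas_oriented : forall c c', atlas c -> atlas c' ->
    oriented_smooth (coord c @` (chart_dom c `&` chart_dom c')) (coord c' \o param c)
}.

Definition oriented_smooth_map (N N' : closed3) (f : N -> N') : Prop :=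
  continuous f /\
  (forall c c', atlas c -> atlas c' ->
    oriented_smooth (coord c @` (chart_dom c `&` f @^-1` chart_dom c'))
                    (coord c' \o f \o param c)).

Definition diffeomorphic (N N' : closed3) : Prop :=
  exists (f : N -> N') (f' : N' -> N),
  [/\ cancel f f', cancel f' f, oriented_smooth_map f
    & oriented_smooth_map f'].

(* N is M(g) capped off with a ball: the maps h v induce an embedding of M(g)
   into N (a continuous injection from a compact space), b is an embedding of
   the ball, and their images cover N and meet exactly along their boundaries.
   The embedding of M(g) is smooth inside each tetrahedron and respects the
   orientations: the frame (01, 02, 03) is negative at positive vertices. *)
Definition capped_off (g : ograph) (N : closed3) : Prop :=
  exists (h : g -> 'rV[R]_3 -> N) (b : 'rV[R]_3 -> N),
  let img (A : set 'rV[R]_3) := [set z | exists v, exists2 y, A y & h v y = z] in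
  [/\ forall v, {within truncated, continuous (h v)},
      forall v w y y', truncated y -> truncated y' ->
        (h v y = h w y' <-> same_point (v, y) (w, y'))
    & forall v c, atlas c ->
        let U := truncated_interior `&` (h v @^-1` chart_dom c) in
        smooth U (coord c \o h v) /\
        (forall y, U y -> Num.sg (\det ('J (coord c \o h v) y)) =
                          if positive v then -1 else 1)] /\
  [/\ {within unit_ball, continuous b},
      {in unit_ball &, injective b},
      img truncated `|` b @` unit_ball = [set: N],
      img truncated `&` b @` unit_ball = b @` unit_sphere
    & img (\bigcup_i cut i) = b @` unit_sphere].

End Realization.

(** * Quotients and generated equivalence relations *)

Definition quot (T : Type) (E : T -> T -> Prop) : Type :=
  {C : T -> Prop | exists x, C = E x}.

Definition quot_class (T : Type) (E : T -> T -> Prop) (x : T) : quot E :=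
  exist _ (E x) (ex_intro _ x erefl).

(* Normal o-graphs are considered up to isomorphism; as [closed_ograph] consists
   of representatives, isomorphic ones are identified here. *)
Definition generated_equiv (R : realType) (move : relation (closed_ograph R)) :
    relation (closed_ograph R) :=
  clos_refl_sym_trans _ (fun G G' : closed_ograph R => iso G G' \/ move G G').

(* The set of closed 3-manifolds up to orientation-preserving diffeomorphism. *)
Definition manifold_class (R : realType) : Type :=
  quot (@diffeomorphic R).

(* Main.v *)
(* The move with apices i, j replaces the tetrahedra T_i, T_j of the boundary of
   a 4-simplex by T_k, T_l, T_m. Sliding a pillow made of T_k and its mirror
   image into the first complex, along the edge lm, makes T_i, T_j, T_k the
   result of a move with apices l, m and opposite sign; undoing that move gives
   the second complex. So, up to pure sliding, the move {i, j} is the inverse of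
   the move {l, m}, and such steps reduce every MP move to the primary one. Only
   one non-sliding move occurs in the resulting sequence, so that all
   intermediate graphs are closed because pure sliding preserves closedness. *)
Require Import Defs.
From mathcomp Require Import all_boot all_fingroup all_classical all_reals.
From mathcomp Require Import zify.
From Stdlib Require Import Relation_Definitions Relation_Operators.

Set Implicit Arguments.
Unset Strict Implicit.
Unset Printing Implicit Defensive.

(** * Opening a pairing along a pair *)

Lemma open_atK (S : eqType) (t : S -> S) (s : S) :
  involutive t -> (forall x, t x != x) -> involutive (open_at t s).
Proof.
move=> tK t_neq [y|[]] /=; last 2 first.
- by rewrite eqxx.
- by rewrite (negPf (t_neq s)) eqxx.
case: eqP => [->//|/eqP ys] /=; case: eqP => [->//|/eqP yts] /=.
by rewrite (can2_eq tK tK) (negPf yts) (can_eq tK) (negPf ys) tK.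
Qed.

(** The values on the new elements are forced: [open_at] pairs [inr true] with [s] and [inr false]
    with [t s], and each must differ from its partner. *)
Definition open_out (S : Type) (s : S) (out : S -> bool) (x : S + bool) : bool :=
  match x with inl y => out y | inr c => c (+) out s end.

Lemma open_at_out (S : eqType) (t : S -> S) (s : S) (out : S -> bool) :
  (forall y, out (t y) = ~~ out y) ->
  forall x, open_out s out (open_at t s x) = ~~ open_out s out x.
Proof.
move=> outt [y|[]] /=; last 2 first.
- by case: (out s).
- by rewrite outt.
case: eqP => [->|_] /=; first by case: (out s).
by case: eqP => [->|_] /=; rewrite outt ?negbK.
Qed.

(** Serves to transfer connectedness: the broken pair is bypassed along [s], [inr true],
    [inr false], [t s], and all other pairs survive the opening. *)
Lemma open_at_closed (S : eqType) (t : S -> S) (s : S) (E : rel (S + bool)) :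
  involutive t -> ssrbool.symmetric E -> ssrbool.transitive E ->
  E (inr true) (inr false) -> (forall x, E x (open_at t s x)) ->
  forall y, E (inl y) (inl (t y)).
Proof.
move=> tK Esym Etr Etf Eopen.
have Es : E (inl s) (inl (t s)).
  apply: (Etr _ _ _ _ (Eopen (inr false))).
  by apply: (Etr _ _ _ _ Etf); rewrite Esym; apply: Eopen (inr true).
move=> y; have := Eopen (inl y) => /=.
case: eqP => [-> //|_]; case: eqP => [-> _|//].
by rewrite tK Esym.
Qed.

(* The slits along f1 = {s, opp s} and f2 separate s and u, which are glued to
   the tetrahedron [inr true], from the remaining complex. Seen from the latter,
   s and u are replaced by the sides of the tetrahedron [inr false]. *)
Definition far_side (S : eqType) (s u y : S) : S + bool + bool :=
  if y == s then inl (inr false) else if y == u then inr false else inl (inl y).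

(** The case [u = t s], where both slits run along one triangle, is included: then [s] and [u] are
    replaced by two elements that are paired with each other. *)
Lemma far_sideP (S : eqType) (t : S -> S) (s u : S) :
  involutive t -> (forall x, t x != x) -> s != u ->
  forall y, open_at (open_at t s) (inl u) (far_side s u y) = far_side s u (t y).
Proof.
move=> tK t_neq su y; have us : (u == s) = false by rewrite eq_sym (negPf su).
have inl_eq a b : (inl a == inl b :> S + bool) = (a == b) by [].
have inrl_eq a c : (inr c == inl a :> S + bool) = false by [].
have tE a b : (t a == b) = (a == t b) := can2_eq tK tK a b.
have slit_u : open_at t s (inl u) = if u == t s then inr false else inl (t u).
  by rewrite /= us.
have [->|ys] := eqVneq y s.
  rewrite /far_side eqxx (negPf (t_neq s)) [t s == u]eq_sym.
  rewrite {1}/open_at inrl_eq slit_u.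
  by case: (u == t s); rewrite ?inrl_eq.
have [->|yu] := eqVneq y u.
  rewrite /far_side us eqxx (negPf (t_neq u)) tE /open_at us.
  by case: (u == t s).
rewrite /far_side (negPf ys) (negPf yu) !tE /open_at us inl_eq (negPf yu) (negPf ys).
have [yts|yts] := eqVneq y (t s).
  by case: (u == t s); rewrite ?inl_eq // yts (inj_eq (inv_inj tK)) (negPf su).
have [uts|uts] := eqVneq u (t s); last by rewrite inl_eq.
by have /negPf-> : y != t u by rewrite uts tK.
Qed.

Lemma near_sideP (S : eqType) (t : S -> S) (s u : S) : s != u ->
  open_at (open_at t s) (inl u) (inl (inr true)) = inl (inl s).
Proof.
move=> su; have us : (u == s) = false by rewrite eq_sym (negPf su).
by rewrite /open_at us; case: (u == t s).
Qed.

(** * O-graphs from orientation-reversing face pairings *)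

(** The parity of a face and the sign of its tetrahedron give the induced orientation, so an
    order-preserving gluing is orientation-reversing exactly when it changes this value. *)
Definition is_out (V : Type) (pos : V -> bool) (x : V * 'I_4) : bool :=
  odd x.2 == pos x.1.

Lemma end_face_is_out (s out over : bool) :
  (odd (end_face s out over) == s) = out.
Proof. by case: s out over => [] [] []. Qed.

Lemma end_face_over (s out over : bool) : (end_face s out over < 2)%N = over.
Proof. by case: s out over => [] [] []. Qed.

Lemma end_faceK (s : bool) (a : 'I_4) :
  end_face s (odd a == s) (a < 2)%N = a.
Proof. by apply: val_inj; case: a s => [[|[|[|[|]]]] ?] []. Qed.

Lemma end_face_id (V : Type) (pos : V -> bool) v (a : 'I_4) c :
  is_out pos (v, a) = c -> end_face (pos v) c (a < 2)%N = a.
Proof. by move=> <-; apply: end_faceK. Qed.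

Section OgraphOfPairing.
Variables (V : finType) (pos : V -> bool) (T : V * 'I_4 -> V * 'I_4).
Hypotheses (TK : involutive T)
  (T_out : forall x, is_out pos (T x) = ~~ is_out pos x).

Definition pairing_match (x : V * bool) : V * bool :=
  let: (w, b) := T (x.1, end_face (pos x.1) true x.2) in (w, (b < 2)%N).

(** A face is determined by its strand once it is known to be an out-end or an in-end. As [T]
    exchanges the two kinds, recording only strands loses nothing. *)
Lemma pairing_matchE v (a : 'I_4) w (b : 'I_4) : is_out pos (v, a) ->
  (pairing_match (v, (a < 2)%N) == (w, (b < 2)%N)) && ~~ is_out pos (w, b)
  = (T (v, a) == (w, b)).
Proof.
move=> va; rewrite /pairing_match /= (end_face_id va).
have := T_out (v, a); rewrite va.
case: (T (v, a)) => w' b' wb'; apply/andP/eqP => [[/eqP[ww' bb'] wb]|[<- <-]].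
  have := end_face_id (negbTE wb); have := end_face_id wb'.
  by rewrite bb' ww' => -> <-.
by rewrite wb'.
Qed.

Lemma pairing_match_inj : injective pairing_match.
Proof.
move=> [v o] [w o']; rewrite /pairing_match /=.
set x := (v, _); set y := (w, _) => E.
have outx : is_out pos x by rewrite /is_out end_face_is_out.
have outy : is_out pos y by rewrite /is_out end_face_is_out.
have /(inv_inj TK)[vw] : T x = T y.
  have := T_out x; have := T_out y; rewrite outx outy /is_out.
  case: (T x) (T y) E => [v' a] [w' b] [-> ab] /= wb wa.
  by rewrite -(end_face_id wa) ab (end_face_id wb).
by rewrite -vw => /(congr1 (fun a : 'I_4 => (a < 2)%N)); rewrite !end_face_over => ->.
Qed.

Hypotheses (V_nonempty : (0 < #|V|)%N)
  (V_connected : forall v w,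
     connect [rel x y | [exists a, exists b, T (x, a) == (y, b)]] v w).

Lemma pairing_connected v w :
  connect [rel x y | [exists a, exists b,
    (perm pairing_match_inj (x, a) == (y, b))
    || (perm pairing_match_inj (y, a) == (x, b))]] v w.
Proof.
apply: connect_sub (V_connected v w) => {}v {}w /existsP[a /existsP[b /eqP E]].
apply/connect1/existsP.
have [va|va] := boolP (is_out pos (v, a)).
  exists (a < 2)%N; apply/existsP; exists (b < 2)%N.
  move/eqP: E; rewrite -pairing_matchE // => /andP[/eqP E _].
  by rewrite permE E eqxx.
have wb : is_out pos (w, b) by rewrite -E T_out.
exists (b < 2)%N; apply/existsP; exists (a < 2)%N.
have /eqP : T (w, b) = (v, a) by rewrite -E TK.
rewrite -pairing_matchE // => /andP[/eqP E' _].
by rewrite !permE E' eqxx orbT.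
Qed.

Definition ograph_of_pairing : ograph :=
  @Ograph V pos (perm pairing_match_inj) V_nonempty pairing_connected.

Lemma opp_ograph_of_pairing x : @opp ograph_of_pairing x = T x.
Proof.
case: x => v a; rewrite /opp.
case: ifPn => va.
  case E : (matching _ _) => [w o]; move: E; rewrite permE => E.
  apply/esym/eqP; rewrite -pairing_matchE // end_face_over E eqxx.
  by rewrite /is_out end_face_is_out.
case E : (fun_of_perm _ _) => [w o]; have := congr1 (matching ograph_of_pairing) E.
rewrite permKV permE => {}E; apply: (canRL TK); apply/eqP.
rewrite -pairing_matchE; last by rewrite /is_out end_face_is_out.
by rewrite end_face_over -E eqxx.
Qed.

End OgraphOfPairing.

Lemma opp_is_out (g : ograph) x :
  is_out (@positive g) (opp x) = ~~ is_out (@positive g) x.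
Proof.
case: x => v a; rewrite /opp /is_out /=.
by case: ifPn => _; case: (fun_of_perm _ _) => w o /=; rewrite end_face_is_out.
Qed.

Lemma oppK (g : ograph) : involutive (@opp g).
Proof.
move=> [v a]; rewrite {2}/opp; case: ifPn => va.
  case E : (matching _ _) => [w o].
  rewrite /opp end_face_is_out end_face_over -E permK.
  by rewrite (end_face_id va).
case E : (fun_of_perm _ _) => [w o].
rewrite /opp end_face_is_out end_face_over -E permKV.
by rewrite (end_face_id (negbTE va)).
Qed.

Lemma opp_neq (g : ograph) (x : g * 'I_4) : opp x != x.
Proof.
apply/eqP => /(congr1 (is_out (@positive g))).
by rewrite opp_is_out; case: is_out.
Qed.

Lemma ograph_opp_connected (g : ograph) (v w : g) :
  connect [rel x y | [exists a, exists b, opp (x, a) == (y, b)]] v w.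
Proof.
apply: connect_sub (ograph_connected v w) => {}v {}w.
have oppE (x : g) o : opp (x, end_face (positive x) true o) =
    ((matching g (x, o)).1,
     end_face (positive (matching g (x, o)).1) false (matching g (x, o)).2).
  by rewrite /opp end_face_is_out end_face_over; case: (matching g _).
move=> /existsP[a /existsP[b /orP[] /eqP E]]; apply/connect1/existsP.
  exists (end_face (positive v) true a); apply/existsP.
  by exists (end_face (positive w) false b); rewrite oppE E.
exists (end_face (positive v) false b); apply/existsP.
exists (end_face (positive w) true a).
by apply/eqP/(canLR (@oppK g)); rewrite oppE E.
Qed.

(** * Inserting a pillow *)

(* [inr true] and [inr false] are the tetrahedra of the pillow; their faces q and
   p are glued to the first and to the second slit, as in [pure_sliding]. *)
Definition pillow_side (V : Type) (p q : 'I_4) (x : V * 'I_4 + bool + bool) :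
    (V + bool) * 'I_4 :=
  match x with
  | inl (inl (v, a)) => (inl v, a)
  | inl (inr c) => (inr c, q)
  | inr c => (inr c, p)
  end.

Definition pillow_side_inv (V : Type) (p q : 'I_4) (x : (V + bool) * 'I_4) :
    option (V * 'I_4 + bool + bool) :=
  match x with
  | (inl v, a) => Some (inl (inl (v, a)))
  | (inr c, a) =>
    if a == q then Some (inl (inr c)) else if a == p then Some (inr c) else None
  end.

(** [pillow_side_inv] is [None] exactly on the faces of the pillow other than [p] and [q]; these are
    glued to the same face of the mirror tetrahedron. *)
Definition pillow_pairing (V : Type) (p q : 'I_4)
    (t : V * 'I_4 + bool + bool -> V * 'I_4 + bool + bool)
    (x : (V + bool) * 'I_4) : (V + bool) * 'I_4 :=
  if pillow_side_inv p q x is Some y then pillow_side p q (t y)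
  else (if x.1 is inr c then inr (~~ c) else x.1, x.2).

Lemma pillow_sideK (V : Type) (p q : 'I_4) : p != q ->
  pcancel (@pillow_side V p q) (pillow_side_inv p q).
Proof.
by move=> pq [[[v a]|c]|c] /=; rewrite ?eqxx // (negPf pq).
Qed.

Lemma pillow_side_invP (V : Type) (p q : 'I_4) (x : (V + bool) * 'I_4) :
  (exists2 y, pillow_side_inv p q x = Some y & x = pillow_side p q y) \/
  exists c a, [/\ pillow_side_inv p q x = None, x = (inr c, a), a != p & a != q].
Proof.
case: x => [[v|c] a] /=; first by left; exists (inl (inl (v, a))).
have [->|aq] := eqVneq a q; first by left; exists (inl (inr c)).
have [->|ap] := eqVneq a p; first by left; exists (inr c).
by right; exists c, a.
Qed.

Lemma pillow_pairing_side (V : Type) (p q : 'I_4) t (y : V * 'I_4 + bool + bool) :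
  p != q -> pillow_pairing p q t (pillow_side p q y) = pillow_side p q (t y).
Proof. by move=> pq; rewrite /pillow_pairing pillow_sideK. Qed.

Lemma pillow_pairing_inner (V : Type) (p q : 'I_4) t c a :
  a != p -> a != q ->
  @pillow_pairing V p q t (inr c, a) = (inr (~~ c), a).
Proof. by move=> /negPf ap /negPf aq; rewrite /pillow_pairing /= ap aq. Qed.

Lemma pillow_pairingK (V : Type) (p q : 'I_4) t : p != q ->
  involutive t -> involutive (@pillow_pairing V p q t).
Proof.
move=> pq tK x; have [[y _ ->]|[c [a [_ -> ap aq]]]] := pillow_side_invP p q x.
  by rewrite !pillow_pairing_side // tK.
by rewrite !pillow_pairing_inner // negbK.
Qed.

(* Pure sliding into [T(g)] is possible as soon as the sign [sg] of the
   tetrahedron [inr true] makes the new gluings orientation-reversing. *)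
Lemma pure_sliding_exists (g : ograph) (p q : 'I_4) (s u : g * 'I_4) (sg : bool) :
  p != q -> admissible p q ->
  (exists n, iter n (walk s) (inr true, rank q p) = (inl u, rank p q)) ->
  s != u ->
  (odd q == sg) = ~~ is_out (@positive g) s ->
  (odd p == sg) = ~~ is_out (@positive g) u ->
  exists (g1 : ograph) (h : g + bool -> g1),
  let new_side x := (h (pillow_side p q x).1, (pillow_side p q x).2) in
  pure_sliding g g1 /\
  [/\ bijective h,
      forall v, positive (h (inl v)) = positive v,
      forall c, positive (h (inr c)) = (c == sg),
      forall x, opp (new_side x) = new_side (open_at (open_at (@opp g) s) (inl u) x)
    & forall c a, a != p -> a != q -> opp (h (inr c), a) = (h (inr (~~ c)), a)].
Proof.
move=> pq adm turn su qs pu.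
set t := open_at (open_at (@opp g) s) (inl u).
have slitK : involutive (open_at (@opp g) s) := open_atK s (@oppK g) (@opp_neq g).
have slit_out := open_at_out (t := @opp g) s (@opp_is_out g).
have slit_neq x : open_at (@opp g) s x != x.
  apply/eqP => /(congr1 (open_out s (is_out (@positive g)))).
  by rewrite slit_out; case: open_out.
have tK : involutive t := open_atK (inl u) slitK slit_neq.
have t_out := open_at_out (inl u) slit_out; rewrite -/t in t_out.
pose pos (x : g + bool) := match x with inl v => positive v | inr c => c == sg end.
pose T := @pillow_pairing g p q t.
have TK : involutive T := pillow_pairingK pq tK.
(* The hypotheses on [sg] concern the faces of [inr true]. The opposite sign of [inr false] gives
   its faces the opposite values, as the other sides of the slits require. *)
have side_out y : is_out pos (pillow_side p q y) =
    open_out (inl u) (open_out s (is_out (@positive g))) y.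
  have flip (c b : bool) : (b == (c == sg)) = c (+) ~~ (b == sg).
    by case: c; case: b; case: (sg).
  by case: y => [[[v a]|c]|c] //; rewrite /is_out /= flip ?qs ?pu negbK.
have T_out x : is_out pos (T x) = ~~ is_out pos x.
  have [[y _ ->]|[c [a [_ -> ap aq]]]] := pillow_side_invP p q x.
    by rewrite /T pillow_pairing_side // !side_out t_out.
  rewrite /T pillow_pairing_inner // /is_out /=.
  by case: c; case: (odd a); case: (sg).
have V_nonempty : (0 < #|{: g + bool}|)%N by apply/card_gt0P; exists (inr true).
pose adj := [rel x y : g + bool | [exists a, exists b, T (x, a) == (y, b)]].
have adjT x a : adj x (T (x, a)).1.
  apply/existsP; exists a; apply/existsP; exists (T (x, a)).2.
  by rewrite -surjective_pairing.
have adj_sym : connect_sym adj.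
  apply: sym_connect_sym => x y; apply/existsP/existsP;
  by move=> [a /existsP[b /eqP E]]; exists b; apply/existsP; exists a; rewrite -E TK.
have inr_adj : connect adj (inr true) (inr false).
  have [a ap aq] : exists2 a : 'I_4, a != p & a != q.
    have /card_gt0P[a] : (0 < #|~: [set p; q]|)%N.
      by have := cardsC [set p; q]; rewrite cards2 card_ord; case: (p != q); lia.
    by rewrite !inE negb_or => /andP[]; exists a.
  by apply: connect1; have := adjT (inr true) a; rewrite /T pillow_pairing_inner.
have V_connected v w : connect adj v w.
  (* Connectedness is pulled back to sides. The second slit is closed first, then the first one;
     each time the pillow joins the two banks of the slit. *)
  pose E1 : rel (g * 'I_4 + bool + bool) := fun x y =>
    connect adj (pillow_side p q x).1 (pillow_side p q y).1.
  have E1_sym : ssrbool.symmetric E1 by move=> x y; apply: adj_sym.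
  have E1_tr : ssrbool.transitive E1 by move=> y x z; apply: connect_trans.
  have E1_t x : E1 x (t x).
    rewrite /E1 -pillow_pairing_side // -/T; apply: connect1.
    by rewrite [X in T X]surjective_pairing; apply: adjT.
  have E1_slit := open_at_closed slitK E1_sym E1_tr inr_adj E1_t.
  pose E0 : rel (g * 'I_4 + bool) := fun x y => E1 (inl x) (inl y).
  have E0_sym : ssrbool.symmetric E0 by move=> x y; apply: E1_sym.
  have E0_tr : ssrbool.transitive E0 by move=> y x z; apply: E1_tr.
  have E0_opp := open_at_closed (@oppK g) E0_sym E0_tr inr_adj E1_slit.
  have adj_opp (x y : g) a b : opp (x, a) = (y, b) -> connect adj (inl x) (inl y).
    by move=> E; have := E0_opp (x, a); rewrite E.
  have inl_adj (x y : g) : connect adj (inl x) (inl y).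
    case/connectP: (ograph_opp_connected x y) => r; elim: r x => [|z r IH] x /=.
      by move=> _ ->; apply: connect0.
    case/andP=> /existsP[a /existsP[b /eqP/adj_opp xz]] zr yE.
    exact: connect_trans xz (IH _ zr yE).
  have inr_inl c : connect adj (inr c) (inl s.1).
    have s1 : connect adj (inr true) (inl s.1).
      apply: connect1; have := adjT (inr true) q.
      have -> : T (inr true, q) = (inl s.1, s.2); last by [].
      rewrite -[(inr true, q)]/(pillow_side p q (inl (inr true))) /T.
      by rewrite pillow_pairing_side // /t near_sideP //; case: (s).
    by case: c => //; apply: connect_trans s1; rewrite adj_sym.
  have to_s x : connect adj x (inl s.1) by case: x => [x|c].
  by apply: connect_trans (to_s v) _; rewrite adj_sym.
exists (ograph_of_pairing TK T_out V_nonempty V_connected), id.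
have oppE := @opp_ograph_of_pairing _ pos T TK T_out V_nonempty V_connected.
have glue x := etrans (oppE (pillow_side p q x)) (pillow_pairing_side t x pq).
have inner c a (ap : a != p) (aq : a != q) :=
  etrans (oppE (inr c, a)) (pillow_pairing_inner t c ap aq).
split; last first.
  split=> //; first by exists id.
  by move=> x; rewrite -!surjective_pairing.
exists p, q, s, (inl u), id; split; [|split; [|split]] => //.
- split=> //=; first by exists id.
  by case: sg {qs pu pos T TK side_out T_out V_nonempty adj adjT
    adj_sym inr_adj V_connected oppE glue inner}.
- by move=> a ap aq; apply: inner.
Qed.

(** * Labels and ranks in the 4-simplex *)

Lemma rankK n (a b : 'I_n.+2) : b != a -> lift a (rank a b) = b.
Proof. by rewrite /rank eq_sym => /unlift_some[c -> ->]. Qed.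

Lemma val_rank n (a b : 'I_n.+2) : b != a -> rank a b = b - (a < b) :> nat.
Proof.
move=> /rankK E; rewrite -[in RHS]E /= /bump.
by case: leqP => /=; lia.
Qed.

Lemma rank_lift n (a : 'I_n.+2) r : rank a (lift a r) = r.
Proof. by rewrite /rank liftK. Qed.

Lemma rank_inj n (a b c : 'I_n.+2) :
  b != a -> c != a -> rank a b = rank a c -> b = c.
Proof. by move=> ba ca E; rewrite -(rankK ba) E rankK. Qed.

(** Both sides are the position of [j] once [i] and [k] are removed, in either order: the triangle
    missing [i] and [k] has the same vertex order in both tetrahedra. *)
Lemma rank_rank n (i j k : 'I_n.+3) : i != j -> j != k -> i != k ->
  rank (rank i k) (rank i j) = rank (rank k i) (rank k j).
Proof.
move=> ij jk ik; have [ji kj ki] : [/\ j != i, k != j & k != i].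
  by rewrite ![_ == i]eq_sym [k == j]eq_sym.
have ne1 : rank i j != rank i k by apply: contra jk => /eqP/(rank_inj ji ki)->.
have ne2 : rank k j != rank k i by apply: contra ij => /eqP/(rank_inj jk ik)->.
apply: ord_inj; rewrite !val_rank //.
move: ij jk ik; rewrite -!val_eqE /=; lia.
Qed.

Lemma odd_rank n (i k : 'I_n.+2) : k != i -> odd (rank i k) = odd k (+) (i < k)%N.
Proof.
move=> ki; rewrite val_rank //.
by case: ltnP => ik /=; rewrite ?subn0 ?addbF // oddB //; lia.
Qed.

(** The configurations in which [i] and [j] are forbidden as third vertices for a sliding along the
    edge [lm], together with their images under exchanging the pairs are the same set. *)
Definition separated n (i j l m : 'I_n) : bool :=
  [&& i < l, i < m, j < l & j < m]%N || [&& l < i, l < j, m < i & m < j]%N.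

(** Passing to ranks in the tetrahedron missing [k] preserves the order, and testing against the
    ranks of [l] and [m] refutes both forbidden cases. *)
Lemma admissible_rank n (i j k l m : 'I_n.+2) :
  uniq [:: i; j; k; l; m] -> ~~ separated i j l m ->
  admissible (rank k j) (rank k i).
Proof.
rewrite /= !inE !negb_or.
move=> /and5P[/and4P[ij ik il im] /and3P[jk jl jm] /andP[kl km] lm _].
rewrite -!(eq_sym k) in ik jk *.
have val_ne (a b : 'I_n.+2) : k != a -> k != b -> a != b -> rank k a != rank k b.
  by move=> ka kb; apply: contra => /eqP/rank_inj->; rewrite // eq_sym.
have lt_ne (a b : 'I_n.+2) : k != a -> k != b ->
    (rank k a < rank k b)%N = (a < b)%N.
  rewrite -!(eq_sym _ k) => ak bk; rewrite !val_rank //.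
  by move: ak bk; rewrite -!val_eqE /=; lia.
move=> /andP[sep1 sep2].
apply/andP; split; apply/negP => /forallP H.
  have := H (rank k l); have := H (rank k m).
  rewrite !val_ne ?(eq_sym m) ?(eq_sym l) // !lt_ne //= => /andP[j_m i_m] /andP[j_l i_l].
  by rewrite j_m i_m j_l i_l in sep1.
have := H (rank k l); have := H (rank k m).
rewrite !val_ne ?(eq_sym m) ?(eq_sym l) // !lt_ne //= => /andP[j_m i_m] /andP[j_l i_l].
by rewrite j_m i_m j_l i_l in sep2.
Qed.

(** * Sides of the bipyramid and their signs *)

Definition side_of (K V : Type) (f : K + 'I_5 -> V) (o : K * 'I_4 + 'I_5 * 'I_5) :
    V * 'I_4 :=
  match o with
  | inl (x, a) => (f (inl x), a)
  | inr (k, l) => (f (inr k), rank k l)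
  end.

(** The condition [l != k] excludes the default value of [rank k k], which would spoil the
    injectivity of [side_of]. *)
Definition valid_side (K : Type) (D : K + 'I_5 -> bool)
    (o : K * 'I_4 + 'I_5 * 'I_5) : bool :=
  match o with
  | inl (x, a) => D (inl x)
  | inr (k, l) => D (inr k) && (l != k)
  end.

(** The outer triangle missing [k] and [l] belongs to one of these two tetrahedra before a move and
    to the other one after it. *)
Definition swap_side (K : Type) (o : K * 'I_4 + 'I_5 * 'I_5) :=
  if o is inr (k, l) then inr (l, k) else o.

Lemma side_of_inj (K V : Type) (D : K + 'I_5 -> bool) (f : K + 'I_5 -> V) :
  (forall x y, D x -> D y -> f x = f y -> x = y) ->
  forall o o', valid_side D o -> valid_side D o' ->
  side_of f o = side_of f o' -> o = o'.
Proof.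
move=> finj [[x a]|[k l]] [[y b]|[k' l']] /=.
- by move=> Dx Dy [/(finj _ _ Dx Dy)[->] ->].
- by move=> Dx /andP[Dk' _] [/(finj _ _ Dx Dk')].
- by move=> /andP[Dk _] Dy [/(finj _ _ Dk Dy)].
- move=> /andP[Dk lk] /andP[Dk' lk'] [/(finj _ _ Dk Dk')[kk'] E].
  by rewrite -kk' in lk' E *; rewrite (rank_inj lk lk' E).
Qed.

Lemma exists_uniqueP (A B : Type) (D : A -> bool) (f : A -> B) :
  (forall v, exists! x, D x /\ f x = v) <->
  (forall x y, D x -> D y -> f x = f y -> x = y) /\
  (forall v, exists2 x, D x & f x = v).
Proof.
split=> [H|[finj fsur] v].
  split=> [x y Dx Dy E|v]; last by have [x [[]]] := H v; exists x.
  by have [z [_ U]] := H (f x); rewrite -(U x) // -(U y).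
have [x Dx <-] := fsur v; exists x; split=> // y [Dy E].
exact: finj.
Qed.

Lemma mem_uniq5 (i j k l m x : 'I_5) :
  uniq [:: i; j; k; l; m] -> x \in [:: i; j; k; l; m].
Proof.
move=> /card_uniqP sz; apply/negPn/negP => xs.
set r := [:: i; j; k; l; m] in sz xs.
have : (0 < #|[predC r]|)%N by apply/card_gt0P; exists x.
have : #|r| + #|[predC r]| = #|r| + 0 by rewrite cardC addn0 sz card_ord.
by move/addnI => ->.
Qed.

(** The identity that the boundary of a boundary vanishes: with the signs of the boundary of the
    4-simplex, two tetrahedra induce opposite orientations on their common triangle. *)
Lemma odd_rankC n (i k : 'I_n.+2) (e : bool) : i != k ->
  (odd (rank k i) == odd k (+) e) = ~~ (odd (rank i k) == odd i (+) e).
Proof.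
move=> ik; have ki : k != i by rewrite eq_sym.
rewrite !odd_rank //; have [ik'|ki'|/val_inj E] := ltngtP i k;
  last by rewrite E eqxx in ik.
  by case: (odd i); case: (odd k); case: e.
by case: (odd i); case: (odd k); case: e.
Qed.

(** * Exchanging the apex pair by sliding *)

Lemma bipyramid_move_slide (i j k l m : 'I_5) (e : bool) (g g' : ograph) :
  uniq [:: i; j; k; l; m] -> ~~ separated i j l m ->
  bipyramid_move i j e g g' ->
  exists g1 : ograph, pure_sliding g g1 /\ bipyramid_move l m (~~ e) g' g1.
Proof.
move=> U sep [K [h [h' [ij [H [opp_ij opp_after glue]]]]]].
have [h_ex h'_ex posK pos_before pos_after] := H.
have all5 x := mem_uniq5 x U; have adm := admissible_rank U sep.
have [hI hS] := (exists_uniqueP _ _).1 h_ex.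
have [h'I h'S] := (exists_uniqueP _ _).1 h'_ex.
move: U all5 {h_ex h'_ex sep} => /=; rewrite !inE !negb_or.
move=> /and5P[/and4P[_ ik il im] /and3P[jk jl jm] /andP[kl km] lm _] all5.
have ne_sym (a b : 'I_5) : a != b -> b != a by rewrite eq_sym.
have [ji ki li mi] := And4 (ne_sym _ _ ij) (ne_sym _ _ ik) (ne_sym _ _ il) (ne_sym _ _ im).
have [kj lj mj] := And3 (ne_sym _ _ jk) (ne_sym _ _ jl) (ne_sym _ _ jm).
have [lk mk ml] := And3 (ne_sym _ _ kl) (ne_sym _ _ km) (ne_sym _ _ lm).
(* Both triangles contain the edge [lm]. The third vertex is [j] for [s] and [i] for [u], so in the
   pillow [{i, j, l, m}] the places [p], [q] are [rank k j], [rank k i]. *)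
pose s := (h (inr i), rank i k); pose u := (h (inr j), rank j k).
have su : s != u.
  apply/eqP => -[/hI] /=; rewrite !eqxx orbT /= => /(_ isT isT) [/eqP].
  by rewrite (negPf ij).
(* Turning around [lm]: the first step goes from the slit into the tetrahedron [i], the second
   crosses the inner triangle into the tetrahedron [j] and reaches [u]. *)
have turn : iter 2 (walk s) (inr true, rank (rank k i) (rank k j)) =
    (inl u, rank (rank k j) (rank k i)).
  have ne : rank i j != rank i k by apply: contra jk => /eqP/rank_inj->.
  have ne' : rank j k != rank j i by apply: contra ki => /eqP/rank_inj->.
  have -> : iter 2 (walk s) (inr true, rank (rank k i) (rank k j)) =
      walk s (inl (h (inr i), rank i j), rank (rank i j) (rank i k)).
    by rewrite -rank_rank // /= {2}/walk /= rankK.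
  have slit_ij : open_at (@opp g) s (inl (h (inr i), rank i j)) = inl (h (inr j), rank j i).
    rewrite /open_at.
    have /negPf-> : (h (inr i), rank i j) != s by apply: contra ne => /eqP[->].
    have /negPf-> : (h (inr i), rank i j) != opp s.
      rewrite -(inj_eq (inv_inj (@oppK g))) oppK opp_ij.
      apply/eqP => -[/hI] /=; rewrite !eqxx orbT /= => /(_ isT isT) [/eqP].
      by rewrite (negPf ji).
    by rewrite opp_ij.
  by rewrite /walk slit_ij /= rank_rank // rankK // rank_rank.
have pos_i : positive (h (inr i)) = odd i (+) e by apply: pos_before; rewrite eqxx.
have pos_j : positive (h (inr j)) = odd j (+) e by apply: pos_before; rewrite eqxx orbT.
have qs : (odd (rank k i) == odd k (+) e) = ~~ is_out (@positive g) s.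
  by rewrite /is_out /= pos_i odd_rankC.
have pu : (odd (rank k j) == odd k (+) e) = ~~ is_out (@positive g) u.
  by rewrite /is_out /= pos_j odd_rankC.
have pq : rank k j != rank k i by apply: contra ji => /eqP/rank_inj->.
have [g1 [h1 [slide [h1_bij pos_inl pos_inr opp_outer opp_inner]]]] :=
  pure_sliding_exists pq adm (ex_intro _ 2 turn) su qs pu.
exists g1; split=> //.
pose new_side x :=
  (h1 (pillow_side (rank k j) (rank k i) x).1, (pillow_side (rank k j) (rank k i) x).2).
have opp_far y : opp (new_side (far_side s u y)) = new_side (far_side s u (opp y)).
  by rewrite opp_outer far_sideP //; [apply: oppK | apply: opp_neq].
pose apex a := (a == i) || (a == j); pose apex' a := (a == l) || (a == m).
have apexN a : ~~ apex a = (a == k) || apex' a.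
  rewrite /apex /apex'; have := all5 a; rewrite !inE => /or4P[|||/orP[]] /eqP->;
  by rewrite ?eqxx ?orbT // ?(negPf ij) ?(negPf ik) ?(negPf il) ?(negPf im) ?(negPf ji)
    ?(negPf ki) ?(negPf kj)
    ?(negPf li) ?(negPf lj) ?(negPf mi) ?(negPf mj) ?(negPf jk) ?(negPf jl) ?(negPf jm).
(* The extra exterior tetrahedron is [k] in [g'] and the mirror copy [inr false] in [g1]; the copy
   [inr true] joins [i] and [j] around the edge [lm]. *)
pose K' := (K + unit)%type.
pose old (x : K' + 'I_5) : K + 'I_5 :=
  match x with inl (inl x) => inl x | inl (inr _) => inr k | inr a => inr a end.
pose f' x := h' (old x).
pose f1 (x : K' + 'I_5) : g1 := h1
  match x with
  | inl (inl x) => inl (h (inl x))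
  | inl (inr _) => inr false
  | inr a => if a == k then inr true else inl (h (inr a))
  end.
pose before' (x : K' + 'I_5) := if x is inr a then apex' a else true.
pose after' (x : K' + 'I_5) := if x is inr a then ~~ apex' a else true.
have apex'Nk : ~~ apex' k by rewrite /apex' negb_or kl km.
have after'E a : ~~ apex' a -> a != k -> apex a.
  by move=> a1 a2; rewrite -[apex a]negbK apexN negb_or a1 a2.
have f'I x y : before' x -> before' y -> f' x = f' y -> x = y.
  rewrite /f'.
  have after_old z : before' z -> if old z is inr a then ~~ apex a else true.
    by case: z => [[z|[]]|a] //=; rewrite apexN ?eqxx // => ->; rewrite orbT.
  move=> Dx Dy /(h'I _ _ (after_old _ Dx) (after_old _ Dy)).
  case: x y Dx Dy => [[x|[]]|a] [[y|[]]|b] //= Dx Dy [].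
  - by move->.
  - by move=> E; rewrite -E (negPf apex'Nk) in Dy.
  - by move=> E; rewrite E (negPf apex'Nk) in Dx.
  - by move->.
have f1I x y : after' x -> after' y -> f1 x = f1 y -> x = y.
  move=> Dx Dy /(bij_inj h1_bij).
  case: x y Dx Dy => [[x|[]]|a] [[y|[]]|b] //=.
  - by move=> _ _ [/(hI (inl x) (inl y) isT isT)[->]].
  - move=> _ b1; case: eqP => // /eqP/(after'E _ b1) b2.
    by move=> [/(hI (inl x) (inr b) isT b2)].
  - by move=> _ _; case: eqP.
  - move=> a1 _; case: eqP => // /eqP/(after'E _ a1) a2.
    by move=> [/(hI (inr a) (inl y) a2 isT)].
  - by move=> _ _; case: eqP.
  - move=> a1 b1; case: (a =P k) (b =P k) => [->|/eqP/(after'E _ a1) a2]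
      [->|/eqP/(after'E _ b1) b2] //.
    by move=> [/(hI (inr a) (inr b) a2 b2)[->]].
have f'S v : exists2 x, before' x & f' x = v.
  have [[x|a] Dx <-] := h'S v; first by exists (inl (inl x)).
  move: Dx; rewrite apexN; have [-> _|_ Da] := eqVneq a k; first by exists (inl (inr tt)).
  by exists (inr a).
have f1S v : exists2 x, after' x & f1 x = v.
  have [h1V _ h1VK] := h1_bij; rewrite -(h1VK v).
  case: (h1V v) => [w|[]]; last 2 first.
  - by exists (inr k); rewrite // /f1 eqxx.
  - by exists (inl (inr tt)).
  have [[x|a] Da <-] := hS w; first by exists (inl (inl x)).
  have [ak a1] : a != k /\ ~~ apex' a.
    apply/andP; apply: contraLR Da; rewrite negb_and !negbK.
    by rewrite -[X in ~~ X]/(apex a) apexN.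
  by exists (inr a); rewrite // /f1 (negPf ak).
pose sideA o := side_of h o; pose sideB o := side_of h' (swap_side o).
pose sideA' o := side_of f' o; pose sideB' o := side_of f1 (swap_side o).
pose outer (o : K * 'I_4 + 'I_5 * 'I_5) :=
  if o is inr (a, b) then apex a && ~~ apex b else true.
pose outer' (o : K' * 'I_4 + 'I_5 * 'I_5) :=
  if o is inr (a, b) then apex' a && ~~ apex' b else true.
have gluing o o' : outer o -> outer o' ->
    (opp (sideA o) = sideA o' <-> opp (sideB o) = sideB o').
  by move=> Oo Oo'; have := glue o o' Oo Oo'; case: (o) (o') => [[x a]|[a b]] [[y c]|[c d]].
pose before (x : K + 'I_5) := if x is inr a then apex a else true.
have sideA_inj := side_of_inj (D := before) hI.
have apex_i : apex i by rewrite /apex eqxx.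
have apex_j : apex j by rewrite /apex eqxx orbT.
have outer_valid o : outer o -> valid_side before o.
  case: o => [[x a]|[a b]] //= /andP[Da Db]; rewrite Da /=.
  by apply: contra Db => /eqP->.
(* The only sides of the bipyramid that are not outer are the two copies of its inner triangle,
   glued to each other. Hence an outer side has an outer partner, which by [gluing] is the same
   before and after. *)
have partner o : outer o -> exists o',
    [/\ outer o', opp (sideA o) = sideA o' & opp (sideB o) = sideB o'].
  move=> Oo; suff [o' Oo' E] : exists2 o', outer o' & opp (sideA o) = sideA o'.
    by exists o'; split=> //; apply/gluing.
  case E : (opp (sideA o)) => [v b]; have [[x|a] Da xv] := hS v.
    by exists (inl (x, b)); rewrite // /sideA /= xv.
  have {}Da : apex a := Da.
  have [c bE ca] : exists2 c, b = rank a c & c != a.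
    by exists (lift a b); [rewrite rank_lift | apply: ne_sym; apply: neq_lift].
  have [Dc|Dc] := boolP (apex c); last first.
    by exists (inr (a, c)); rewrite /sideA /= -?xv -?bE //; apply/andP.
  have bad : opp (sideA o) = sideA (inr (a, c)) by rewrite E -xv bE.
  have Oca : ~~ outer (inr (c, a)) by rewrite /= negb_and negbK Da orbT.
  case/negP: Oca; rewrite (_ : inr (c, a) = o) //.
  apply: sideA_inj; [by rewrite /= Dc ne_sym | exact: outer_valid |].
  rewrite -[RHS](oppK (g := g)) bad.
  move: Da Dc ca => /orP[]/eqP-> /orP[]/eqP->; rewrite ?eqxx // => _.
  exact: canRL (@oppK g) opp_ij.
have far_id y : y != s -> y != u -> far_side s u y = inl (inl y).
  by rewrite /far_side => /negPf-> /negPf->.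
have sideA_sE a b : apex a -> b != a ->
    ((sideA (inr (a, b)) == s) = ((a, b) == (i, k))) *
    ((sideA (inr (a, b)) == u) = ((a, b) == (j, k))).
  move=> Da ba.
  have V c : apex c -> k != c -> valid_side before (inr (c, k)).
    by move=> Dc kc; apply/andP.
  have Vab : valid_side before (inr (a, b)) by apply/andP.
  split; apply/idP/idP => [/eqP E|/eqP[-> ->] //]; apply/eqP.
    by case: (sideA_inj _ _ Vab (V i apex_i ki) E) => -> ->.
  by case: (sideA_inj _ _ Vab (V j apex_j kj) E) => -> ->.
have f1_apex a : apex a -> f1 (inr a) = h1 (inl (h (inr a))).
  rewrite /f1; have [->|//] := eqVneq a k.
  by rewrite /apex (negPf ki) (negPf kj).
(* The three triangles around [lm] in [g1]: this one is inherited from [g], the other two come from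
   gluing [inr true] to [s] and [u]. *)
have opp_side_ij : opp (f1 (inr i), rank i j) = (f1 (inr j), rank j i).
  have := opp_far (sideA (inr (i, j))).
  rewrite (_ : opp (sideA (inr (i, j))) = sideA (inr (j, i))); last exact: opp_ij.
  rewrite !far_id ?sideA_sE ?xpair_eqE ?(negPf ij) ?(negPf ji)
    ?(negPf ik) ?(negPf jk) ?andbF //.
  by rewrite /new_side /= !f1_apex.
have opp_side_ki : opp (f1 (inr k), rank k i) = (f1 (inr i), rank i k).
  by have := opp_outer (inl (inr true)); rewrite near_sideP // (f1_apex i) // {1}/f1 eqxx.
have opp_side_kj : opp (f1 (inr k), rank k j) = (f1 (inr j), rank j k).
  have := opp_outer (inr true); rewrite (f1_apex j) // {1}/f1 eqxx.
  by [].
have apexNk : ~~ apex k by rewrite apexN eqxx.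
have apexNl : ~~ apex l by rewrite apexN /apex' eqxx orbT.
have apexNm : ~~ apex m by rewrite apexN /apex' eqxx !orbT.
exists K', f', f1; split=> //; split; [split | split].
- exact: ((exists_uniqueP before' f').2 (conj f'I f'S)).
- exact: ((exists_uniqueP after' f1).2 (conj f1I f1S)).
- case=> [x|[]]; first by rewrite /f1 pos_inl -posK.
  rewrite /f1 pos_inr /f' /= pos_after ?apexN ?eqxx //.
- move=> a Da; have {}Da : apex' a := Da.
  rewrite /f' /= pos_after; first by rewrite addbN.
  by rewrite -/(apex a) apexN Da orbT.
- move=> a Da; rewrite /f1 addbN negbK.
  case: eqP => [->|/eqP/(after'E _ Da) a1]; first by rewrite pos_inr.
  by rewrite pos_inl pos_before.
- exact: opp_after.
- move=> a b Da Db ab.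
  have [ak|/(after'E _ Da)/orP Da'] := eqVneq a k;
  have [bk|/(after'E _ Db)/orP Db'] := eqVneq b k.
  + by rewrite ak bk eqxx in ab.
  + by rewrite ak; case: Db' => /eqP->.
  + by rewrite bk; apply: (canLR (@oppK g1)); case: Da' => /eqP->.
  + case: Da' Db' ab => /eqP-> [] /eqP->; rewrite ?eqxx // => _.
    by apply: (canLR (@oppK g1)).
have partner' o : outer' o -> exists o',
    [/\ outer' o', opp (sideA' o) = sideA' o' & opp (sideB' o) = sideB' o'].
  (* [new] renames the outer sides of the first bipyramid for the move with apices [l], [m]; a
     triangle missing [k] now lies on the extra exterior tetrahedron. *)
  pose new (o : K * 'I_4 + 'I_5 * 'I_5) : K' * 'I_4 + 'I_5 * 'I_5 :=
    match o with
    | inl (x, a) => inl (inl x, a)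
    | inr (a, b) => if b == k then inl (inr tt, rank k a) else inr (b, a)
    end.
  have newA o1 : outer o1 -> sideA' (new o1) = sideB o1.
    case: o1 => [[x a]|[a b]] //= _.
    by case: eqP => [->|].
  have newB o1 : outer o1 -> sideB' (new o1) = new_side (far_side s u (sideA o1)).
    case: o1 => [[x a]|[a b]] Oo1.
      rewrite far_id //; apply/eqP.
        by move/(sideA_inj (inl (x, a)) (inr (i, k)) isT); rewrite /= apex_i ki => /(_ isT).
      by move/(sideA_inj (inl (x, a)) (inr (j, k)) isT); rewrite /= apex_j kj => /(_ isT).
    have /andP[Da ba] := outer_valid _ Oo1.
    rewrite /new; have [bk|bk] := eqVneq b k.
      rewrite bk; case/orP: Da => /eqP->.
        by rewrite -[sideA _]/s /far_side eqxx.
      by rewrite -[sideA _]/u /far_side eqxx eq_sym (negPf su).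
    rewrite far_id ?sideA_sE ?xpair_eqE ?(negPf bk) ?andbF //.
    by rewrite /sideB' /= f1_apex.
  have new_outer o1 : outer o1 -> outer' (new o1).
    case: o1 => [[x a]|[a b]] //= /andP[Da]; rewrite apexN.
    case: eqP => //= _ Db; rewrite Db /=; apply: contraTN Da => Da.
    by rewrite apexN Da orbT.
  have new_partner o1 : outer o1 -> exists o',
      [/\ outer' o', opp (sideA' (new o1)) = sideA' o' & opp (sideB' (new o1)) = sideB' o'].
    move=> Oo1; have [o2 [Oo2 EA EB]] := partner _ Oo1.
    by exists (new o2); rewrite !newA ?newB ?new_outer // opp_far EA.
  (* The remaining outer sides lie on the triangles missing [k] and one of [l], [m]: interior after
     the first move in [g'], inside the pillow in [g1]. *)
  have inner c : apex' c -> opp (sideA' (inl (inr tt, rank k c))) = sideA' (inr (c, k)) /\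
      opp (sideB' (inl (inr tt, rank k c))) = sideB' (inr (c, k)).
    move=> Dc; have Nc : ~~ apex c by rewrite apexN Dc orbT.
    have ck : c != k by apply: contraNneq apex'Nk => <-.
    split; first by apply: opp_after; rewrite // eq_sym.
    have -> : sideB' (inr (c, k)) = (h1 (inr true), rank k c).
      by rewrite /sideB' /= /f1 eqxx.
    apply: (opp_inner false).
      by apply: contraNneq Nc => /(rank_inj ck jk)->.
    by apply: contraNneq Nc => /(rank_inj ck ik)->.
  case: o => [[[x|[]] a]|[a b]].
  - by move=> _; apply: (new_partner (inl (x, a))).
  - move=> _; have [c -> ck] : exists2 c, a = rank k c & c != k.
      by exists (lift k a); [rewrite rank_lift | apply: ne_sym; apply: neq_lift].
    have [Dc|] := boolP (apex c).
      by have := new_partner (inr (c, k)); rewrite /new eqxx; apply; apply/andP.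
    rewrite apexN (negPf ck) => Dc; have [EA EB] := inner c Dc.
    by exists (inr (c, k)); split=> //; apply/andP.
  - move=> /andP[Da Db]; have [->|bk] := eqVneq b k.
      have [EA EB] := inner a Da.
      by exists (inl (inr tt, rank k a)); split=> //; apply: (canLR (@oppK _)).
    have Db' := after'E _ Db bk.
    have ak : a != k by apply: contraNneq apex'Nk => <-.
    have := new_partner (inr (b, a)); rewrite /new (negPf ak); apply; apply/andP.
    by rewrite apexN Da orbT.
have outer'_valid o : outer' o -> valid_side before' o /\ valid_side after' (swap_side o).
  case: o => [[x a]|[a b]] //= /andP[Da Db]; rewrite Da Db /=.
  have ab : a != b by apply: contraNneq Db => <-.
  by rewrite ab eq_sym ab.
move=> o o' Oo Oo'.
have [o2 [Oo2 EA EB]] := partner' o Oo.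
have [v2 w2] := outer'_valid _ Oo2; have [v' w'] := outer'_valid _ Oo'.
suff : opp (sideA' o) = sideA' o' <-> opp (sideB' o) = sideB' o'.
  by case: (o) (o') => [[x a]|[a b]] [[y c]|[c d]].
have swapK : involutive (@swap_side K') by case=> [[]|[]].
(* By injectivity of the sides, both gluings amount to [o' = o2]. *)
rewrite EA EB; split=> E; first by rewrite (side_of_inj f'I v2 v' E).
by rewrite (inv_inj swapK (side_of_inj f1I w2 w' E)).
Qed.

(** * Reaching all admissible apex pairs from [{1, 3}] *)

(* The steps {i, j} -> {l, m} are the edges of the Petersen graph without its
   vertices {0, 1} and {3, 4}. This graph is connected and contains the 5-cycle
   13-02-14-03-24; the cycle being odd, {1, 3} with sign [false] is reached from
   every pair with either sign. *)
Lemma bipyramid_move_generation (P : 'I_5 -> 'I_5 -> bool -> Prop) :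
  (forall i j k l m e, uniq [:: i; j; k; l; m] -> ~~ separated i j l m ->
     P l m (~~ e) -> P i j e) ->
  P (@Ordinal 5 1 isT) (@Ordinal 5 3 isT) false ->
  forall i j e, i != j -> admissible i j -> P i j e.
Proof.
move=> step P13.
pose o0 := @Ordinal 5 0 isT; pose o1 := @Ordinal 5 1 isT.
pose o2 := @Ordinal 5 2 isT; pose o3 := @Ordinal 5 3 isT.
pose o4 := @Ordinal 5 4 isT.
pose Q i j e := P i j e /\ P j i e.
have next i j k l m e : P l m (~~ e) ->
    uniq [:: i; j; k; l; m] -> uniq [:: j; i; k; l; m] ->
    ~~ separated i j l m -> ~~ separated j i l m -> Q i j e.
  by move=> H U U' S S'; split; [exact: step U S H | exact: step U' S' H].
(* The explicit label is the one outside both pairs. Every step flips the sign; the second sign of a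
   pair comes from going around the odd cycle. *)
have Q02t : Q o0 o2 true by apply: (next _ _ o4 _ _ true P13).
have Q04t : Q o0 o4 true by apply: (next _ _ o2 _ _ true P13).
have Q24t : Q o2 o4 true by apply: (next _ _ o0 _ _ true P13).
have Q13f : Q o1 o3 false by apply: (next _ _ o4 _ _ false Q02t.1).
have Q14f : Q o1 o4 false by apply: (next _ _ o3 _ _ false Q02t.1).
have Q12f : Q o1 o2 false by apply: (next _ _ o3 _ _ false Q04t.1).
have Q23f : Q o2 o3 false by apply: (next _ _ o1 _ _ false Q04t.1).
have Q03f : Q o0 o3 false by apply: (next _ _ o1 _ _ false Q24t.1).
have Q03t : Q o0 o3 true by apply: (next _ _ o2 _ _ true Q14f.1).
have Q23t : Q o2 o3 true by apply: (next _ _ o0 _ _ true Q14f.1).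
have Q12t : Q o1 o2 true by apply: (next _ _ o4 _ _ true Q03f.1).
have Q14t : Q o1 o4 true by apply: (next _ _ o2 _ _ true Q03f.1).
have Q24f : Q o2 o4 false by apply: (next _ _ o1 _ _ false Q03t.1).
have Q02f : Q o0 o2 false by apply: (next _ _ o3 _ _ false Q14t.1).
have Q04f : Q o0 o4 false by apply: (next _ _ o3 _ _ false Q12t.1).
have Q13t : Q o1 o3 true by apply: (next _ _ o4 _ _ true Q02f.1).
have all_ord x : x \in [:: o0; o1; o2; o3; o4] by apply: mem_uniq5.
have not_adm x y : (x, y) \in [:: (o0, o1); (o1, o0); (o3, o4); (o4, o3)] ->
    admissible x y -> False.
  move=> xy; apply/negP; move: xy.
  rewrite !inE /admissible negb_and !negbK => /or4P[]/eqP[-> ->]; apply/orP;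
    [left|left|right|right]; apply/forallP => c; have := all_ord c;
    by rewrite !inE => /or4P[|||/orP[]] /eqP->.
move=> i j e; have := all_ord i; have := all_ord j; rewrite !inE.
move=> /or4P[|||/orP[]] /eqP-> /or4P[|||/orP[]] /eqP-> //= _ adm.
all: first [by apply: False_ind; apply: not_adm adm
           | by case: e; unfold Q in *; tauto].
Qed.

(** * Generation of the equivalence relation and the bijection *)

(* The hypotheses after Phi say, in this order: Phi maps G to the class of G
   capped off with a ball; Phi is onto; the 0-2 move is a special pure sliding
   move; the equivalence relation defined by Phi is generated by the MP moves,
   the 0-2 move and the CP move; pure sliding moves do not change Phi. *)
Theorem corollary2p5 (R : realType)
    (Phi : closed_ograph R -> manifold_class R)
    (Phi_spec : forall G : closed_ograph R, exists N : closed3 R,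
       capped_off G N /\ Phi G = quot_class (@diffeomorphic R) N)
    (Phi_onto : forall m : manifold_class R, exists G, Phi G = m)
    (CP_move zero_two_move : relation (closed_ograph R))
    (zero_two_sliding : forall G G' : closed_ograph R,
       zero_two_move G G' -> pure_sliding G G')
    (Benedetti_Petronio : forall G G' : closed_ograph R,
       Phi G = Phi G' <->
       generated_equiv (fun H H' : closed_ograph R =>
         MP_move H H' \/ zero_two_move H H' \/ CP_move H H') G G')
    (sliding_Phi : forall (G : closed_ograph R) (g : ograph),
       pure_sliding G g \/ pure_sliding g G ->
       exists G' : closed_ograph R, ograph_of G' = g /\ Phi G' = Phi G) :
  let moves (H H' : closed_ograph R) :=
    primary_MP_move H H' \/ pure_sliding H H' \/ CP_move H H' in
  (forall G G' : closed_ograph R, Phi G = Phi G' <-> generated_equiv moves G G') /\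
  (exists F : quot (generated_equiv moves) -> manifold_class R,
     (forall G : closed_ograph R, F (quot_class (generated_equiv moves) G) = Phi G) /\
     bijective F).
Proof.
move=> moves.
have MP_generated (i j : 'I_5) e : i != j -> admissible i j ->
    forall G G' : closed_ograph R, bipyramid_move i j e G G' ->
    generated_equiv moves G G'.
  move: i j e; apply: bipyramid_move_generation; last first.
    by move=> G G' GG'; apply: rst_step; right; left.
  move=> i j k l m e U sep IH G G' /(bipyramid_move_slide U sep)[g1 [GG1 G'G1]].
  (* Closedness of the intermediate graph lets the induction hypothesis apply to the move from [G']
     to it, which is then traversed backwards. *)
  have [G1 [G1E _]] := sliding_Phi G g1 (or_introl GG1).
  rewrite -G1E in GG1 G'G1.
  apply: (rst_trans _ _ _ G1); first by apply: rst_step; right; right; left.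
  exact/rst_sym/IH.
have Phi_generated G G' : Phi G = Phi G' <-> generated_equiv moves G G'.
  split.
    move/Benedetti_Petronio; elim=> {G G'}.
    - move=> G G' [iso_GG'|[[i [j [e [adm mv]]]]|[zt|cp]]].
      + by apply: rst_step; left.
      + by apply: (MP_generated i j e) => //; have [K [h [h' [ij _]]]] := mv.
      + by apply: rst_step; right; right; left; apply: zero_two_sliding.
      + by apply: rst_step; right; right; right.
    - by move=> G; apply: rst_refl.
    - by move=> G G' _; apply: rst_sym.
    - by move=> G G' G'' _ GG' _; apply: rst_trans.
  elim=> {G G'} [G G'|G|G G' _ ->|G G' G'' _ -> _ ->] //.
  case=> [iso_GG'|[prim|[sl|cp]]].
  - by apply/Benedetti_Petronio/rst_step; left.
  - apply/Benedetti_Petronio/rst_step; right; left.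
    exists (@Ordinal 5 1 isT), (@Ordinal 5 3 isT), false; split=> //.
    (* The label 0 is below both apices 1 and 3, and the label 4 is above both. *)
    apply/andP; split; apply/forallPn; [exists ord0|exists ord_max]; by [].
  (* Only the underlying o-graphs of [G1] and [G'] are known to agree, so the two are linked by the
     identity isomorphism. *)
  - have [G1 [G1E <-]] := sliding_Phi G G' (or_introl sl).
    apply/Benedetti_Petronio/rst_step; left; rewrite G1E.
    by exists id; split=> //; [exists id | move=> v o; case: (matching _ _)].
  - by apply/Benedetti_Petronio/rst_step; right; right; right.
split=> //.
pose E := generated_equiv moves.
pose repr (C : quot E) : closed_ograph R := projT1 (cid (proj2_sig C)).
have reprP C : C = quot_class E (repr C).
  rewrite /repr; case: cid => x /= Cx; case: C Cx => C C_ex /= Cx.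
  by apply: eq_exist.
have class_eq G G' : E G G' -> quot_class E G = quot_class E G'.
  move=> GG'; apply: eq_exist; apply/funext => H; apply/propext.
  by split; apply: rst_trans => //; apply: rst_sym.
have F_class G : Phi (repr (quot_class E G)) = Phi G.
  apply/Phi_generated; have := congr1 (@proj1_sig _ _) (reprP (quot_class E G)).
  by move=> /= EG; rewrite -/E -EG; apply: rst_refl.
(* The map is [Phi] on a chosen representative; its inverse sends [m] to the class of a chosen
   preimage under [Phi]. *)
exists (fun C => Phi (repr C)); split=> //.
pose lift_class m := quot_class E (projT1 (cid (Phi_onto m))).
exists lift_class => [C|m]; last by rewrite /lift_class F_class; case: cid.
rewrite [RHS]reprP; apply: class_eq; apply/Phi_generated.
by case: cid.
Qed.
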